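(* Let $k\ge 0$ be an integer and $n=48k+38$; all arithmetic is modulo $n$. Define $c_1(r)=r$ for $0\le r\le n-1$. Define $c_2,c_3:\{0,\dots,n-1\}\to\mathbb{Z}_n$ by: for $0\le i\le 12k+9$, $c_2(2i)=30k+23+i(12k+10)$ and $c_3(2i)=30k+24+i(12k+11)$; for $0\le i\le 12k+8$, $c_2(2i+1)=12k+9+i(12k+10)$ and $c_3(2i+1)=24k+20+i(12k+11)$; and for $0\le r\le 24k+18$ and $\alpha=2,3$, $c_\alpha(n-1-r)=n-1-c_\alpha(r)$. For $\alpha=1,2,3$ let ${\cal L}_\alpha=[l_\alpha(r,j)]$ be the $n\times n$ array with $l_\alpha(r,j)\equiv c_\alpha(r)+j\pmod n$, $0\le r,j\le n-1$. Then ${\cal L}_1,{\cal L}_2,{\cal L}_3$ are three (cyclic) mutually nearly orthogonal Latin squares of order $n$, i.e. they are Latin squares and each pair of them is nearly orthogonal.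
   Context: A Latin square of order $n$ is an $n\times n$ array in which each row and each column contains each of the symbols $0,\dots,n-1$ exactly once. For Latin squares $L=[l(i,j)]$ and $M=[m(i,j)]$ of even order $n$ on symbols $\{0,\dots,n-1\}$, their superimposition is the $n\times n$ array $A=[(l(i,j),m(i,j))]$. $L$ and $M$ are nearly orthogonal if in $A$ every ordered pair $(x,y)$ with $0\le x,y\le n-1$, $x\ne y$, occurs at least once, and each ordered pair $(x,x+n/2)$ (second coordinate taken modulo $n$) occurs exactly twice. A set of Latin squares is mutually nearly orthogonal if every two of them are nearly orthogonal. *)

(* Defs.v *)
From mathcomp Require Import all_boot all_algebra.

Set Implicit Arguments.
Unset Strict Implicit.
Unset Printing Implicit Defensive.

Definition latin_square (n : nat) (L : 'M['I_n]_n) : Prop :=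
  (forall r x : 'I_n, #|[set j : 'I_n | L r j == x]| = 1) /\
  (forall j x : 'I_n, #|[set r : 'I_n | L r j == x]| = 1).

Definition superimposition (n : nat) (L M : 'M['I_n]_n) :
    'M['I_n * 'I_n]_n :=
  \matrix_(r, j) (L r j, M r j).

Definition occurrences (n : nat) (T : eqType) (A : 'M[T]_n) (z : T) : nat :=
  #|[set p : 'I_n * 'I_n | A p.1 p.2 == z]|.

Definition nearly_orthogonal (n : nat) (L M : 'M['I_n]_n) : Prop :=
  [/\ ~~ odd n,
      forall x y : 'I_n, x != y ->
        0 < occurrences (superimposition L M) (x, y)
    & forall x y : 'I_n, y = x + n./2 %[mod n] ->
        occurrences (superimposition L M) (x, y) = 2].

Definition mutually_nearly_orthogonal_latin_squares
    (m n : nat) (Ls : m.-tuple 'M['I_n]_n) : Prop :=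
  (forall a : 'I_m, latin_square (tnth Ls a)) /\
  (forall a b : 'I_m, a != b -> nearly_orthogonal (tnth Ls a) (tnth Ls b)).

(* Elements of Z_n are represented by their residues in {0, .., n-1}, so
   n - 1 - c r is an untruncated subtraction below and needs no reduction. *)
Definition extend_by_reflection (n : nat) (h : nat -> nat) (r : nat) : nat :=
  if r < n./2 then h r %% n else n.-1 - h (n.-1 - r) %% n.

(* The first column of each array; r is meant to range over 0 <= r < n.  The
   reflected functions are given on r <= 24 k + 18, i.e. r < n / 2; there
   r = 2 i or r = 2 i + 1 with i = r./2. *)
Definition c1 (r : nat) : nat := r.

Definition c2 (k : nat) : nat -> nat :=
  extend_by_reflection (48 * k + 38) (fun r =>
    if odd r then 12 * k + 9 + r./2 * (12 * k + 10)
    else 30 * k + 23 + r./2 * (12 * k + 10)).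

Definition c3 (k : nat) : nat -> nat :=
  extend_by_reflection (48 * k + 38) (fun r =>
    if odd r then 24 * k + 20 + r./2 * (12 * k + 11)
    else 30 * k + 24 + r./2 * (12 * k + 11)).

Lemma ltn_pmod_ord (n : nat) (r : 'I_n) (m : nat) : m %% n < n.
Proof. exact: ltn_pmod (leq_ltn_trans (leq0n r) (ltn_ord r)). Qed.

Definition cyclic_array (n : nat) (c : nat -> nat) : 'M['I_n]_n :=
  \matrix_(r, j) Ordinal (ltn_pmod_ord r (c r + j)).

(* Main.v *)
(* Two cyclic arrays with first columns f and g contain the pair (x, y) once for
   each row r with g r - f r = y - x.  Because of the reflection, d = g - f
   satisfies d (n - 1 - r) = - d r, so everything reduces to the n / 2 rows of
   the lower half.  There d is nonzero and injective up to sign, and Z_n has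
   exactly n / 2 nonzero classes up to sign: each is met once.  The class {n / 2}
   is its own opposite, hence is met a second time by the reflected row.
   Injectivity up to sign is linear arithmetic: on each residue class of rows
   modulo 8, c1, c2 and c3 are arithmetic progressions modulo n, of steps 8, 2
   and 6. *)
Require Import Defs.
From mathcomp Require Import all_boot all_algebra.
From mathcomp Require Import zify ring.

Set Implicit Arguments.
Unset Strict Implicit.
Unset Printing Implicit Defensive.

Import GRing.Theory.
Local Open Scope ring_scope.

(** * Residues and classes up to sign in ['Z_n] *)

Lemma Zp_natr_eq (n a b : nat) :
  (1 < n)%N -> (a%:R == b%:R :> 'Z_n) = (a == b %[mod n])%N.
Proof. by move=> n_gt1; rewrite -val_eqE /= !val_Zp_nat. Qed.

Lemma Zp_natrP (n a b : nat) :
  (1 < n)%N -> a%:R = b%:R :> 'Z_n <-> a = b %[mod n].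
Proof.
move=> n_gt1; split=> [/eqP|ab]; first by rewrite Zp_natr_eq // => /eqP.
by apply/eqP; rewrite Zp_natr_eq // ab.
Qed.

(* The far alternatives replace bounds on a and b, so that a final linear
   arithmetic call settles them together with the near ones. *)
Lemma eqn_mod_near (n a b : nat) : a = b %[mod n] ->
  (a = b \/ a = b + n \/ a = b + 2 * n \/ b = a + n \/ b = a + 2 * n \/
   b + 3 * n <= a \/ a + 3 * n <= b)%N.
Proof.
move=> ab; have [le_ab|/ltnW le_ba] := leqP a b.
  have /dvdnP[q qE]: (n %| b - a)%N by rewrite -eqn_mod_dvd // ab.
  by case: q qE => [|[|[|q]]] qE; nia.
have /dvdnP[q qE]: (n %| a - b)%N by rewrite -eqn_mod_dvd // ab.
by case: q qE => [|[|[|q]]] qE; nia.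
Qed.

(** Whichever of z and n - z is at most n/2 serves as absolute value. It is nonzero, so lowering it
    by one lands in ['I_n./2], the same finite type as the rows of the lower half. *)
Lemma Zp_abs (n : nat) (z : 'Z_n) : (1 < n)%N -> ~~ odd n -> z != 0 ->
  exists i : 'I_n./2, z = i.+1%:R \/ z = - i.+1%:R.
Proof.
move=> n_gt1 n_even z_neq0.
have z_gt0 : (0 < z)%N by rewrite lt0n -[0%N]/(val (0 : 'Z_n)) val_eqE.
have ltzn : (z < n)%N by rewrite -[n in (_ < n)%N]Zp_cast.
have [le_zh|lt_hz] := leqP z n./2.
  have lt_i : (z.-1 < n./2)%N by lia.
  by exists (Ordinal lt_i); left; rewrite /= prednK // natr_Zp.
have lt_i : ((n - z).-1 < n./2)%N by lia.
exists (Ordinal lt_i); right; rewrite /= prednK ?subn_gt0 // natrB ?(ltnW ltzn) //.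
by rewrite natr_Zp pchar_Zp // sub0r opprK.
Qed.

(** Taking absolute values of [d] gives a self-map of ['I_n./2]; it is injective, hence bijective by
    finiteness. *)
Lemma surj_up_to_sign (n : nat) (d : nat -> 'Z_n) :
  (1 < n)%N -> ~~ odd n ->
  (forall r, (r < n./2)%N -> d r != 0) ->
  (forall r r', (r < n./2)%N -> (r' < n./2)%N ->
     d r = d r' \/ d r = - d r' -> r = r') ->
  forall z, z != 0 -> exists2 r, (r < n./2)%N & d r = z \/ d r = - z.
Proof.
move=> n_gt1 n_even d_neq0 d_inj z z_neq0.
have d_abs (r : 'I_n./2) : exists i : 'I_n./2, d r = i.+1%:R \/ d r = - i.+1%:R.
  exact: Zp_abs (d_neq0 r _).
have [f fP] := fin_all_exists d_abs.
have f_inj : injective f.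
  move=> r r' frr'; apply/val_inj/d_inj => //=.
  by case: (fP r) => ->; case: (fP r') => ->; rewrite frr' ?opprK; auto.
have [i zi] := Zp_abs n_gt1 n_even z_neq0.
have [g _ fg] := injF_bij f_inj.
exists (g i) => //.
by have := fP (g i); rewrite fg; case: zi => -> [] ->; rewrite ?opprK; auto.
Qed.

(** * Cyclic arrays with reflected first columns *)

Definition reflective (n : nat) (c : nat -> nat) : Prop :=
  forall r, (r < n)%N -> (c r + c (n.-1 - r) = n.-1)%N.

Lemma reflective_id (n : nat) : reflective n id.
Proof. by move=> r ltrn; lia. Qed.

Lemma reflective_extend (n : nat) (h : nat -> nat) :
  ~~ odd n -> reflective n (extend_by_reflection n h).
Proof.
move=> n_even r ltrn; rewrite /extend_by_reflection.
have n_gt0 : (0 < n)%N by lia.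
have [ltrh|lehr] := ltnP r n./2.
  have -> : (n.-1 - r < n./2)%N = false by lia.
  rewrite subKn; last by lia.
  by have := ltn_pmod (h r) n_gt0; lia.
have -> : (n.-1 - r < n./2)%N by lia.
by have := ltn_pmod (h (n.-1 - r)%N) n_gt0; lia.
Qed.

(** As n - 1 is -1 in ['Z_n], reflection sends [c r] to -(c r) - 1; the shift by one cancels in
    differences of two columns. *)
Lemma reflective_Zp (n : nat) (c : nat -> nat) (r : nat) :
  (1 < n)%N -> reflective n c -> (r < n)%N ->
  (c (n.-1 - r)%N)%:R = - (c r).+1%:R :> 'Z_n.
Proof.
move=> n_gt1 c_refl ltrn; apply/eqP; rewrite -addr_eq0 -natrD.
have -> : (c (n.-1 - r) + (c r).+1 = n)%N by have := c_refl r ltrn; lia.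
by rewrite pchar_Zp.
Qed.

Lemma rev_ordE (n : nat) (r : 'I_n) : rev_ord r = (n.-1 - r)%N :> nat.
Proof. by case: n r => [[]|n] //= r; rewrite subSS. Qed.

Lemma card_fiber_inj (T : finType) (f : T -> T) (x : T) :
  injective f -> #|[set r | f r == x]| = 1%N.
Proof.
case/injF_bij=> g fK gK; rewrite -(cards1 (g x)); apply: eq_card => r.
by rewrite !inE (can2_eq fK gK).
Qed.

Lemma cyclic_array_Zp (n : nat) (c : nat -> nat) (r j : 'I_n) :
  (1 < n)%N -> (cyclic_array n c r j)%:R = (c r)%:R + j%:R :> 'Z_n.
Proof.
by move=> n_gt1; apply/eqP; rewrite mxE /= -natrD Zp_natr_eq // modn_mod.
Qed.

Lemma ord_Zp_inj (n : nat) (i j : 'I_n) :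
  (1 < n)%N -> i%:R = j%:R :> 'Z_n -> i = j.
Proof.
move=> n_gt1 /eqP; rewrite Zp_natr_eq // !modn_small // => /eqP.
exact: val_inj.
Qed.

(** Each array row is a translation, so only injectivity of [c] modulo n matters. Within one half it
    is [c_inj], up to reflection; a coincidence between opposite halves would make two lower values
    sum to n - 1, against [c_opp]. *)
Lemma latin_square_cyclic (n : nat) (c : nat -> nat) :
  (1 < n)%N -> ~~ odd n -> reflective n c ->
  (forall r r', (r < n./2)%N -> (r' < n./2)%N ->
     c r = c r' %[mod n] -> r = r') ->
  (forall r r', (r < n./2)%N -> (r' < n./2)%N ->
     c r + c r' <> n.-1 %[mod n])%N ->
  latin_square (cyclic_array n c).
Proof.
move=> n_gt1 n_even c_refl c_inj c_opp.
have c_rev (r : 'I_n) : (c (rev_ord r))%:R = - (c r).+1%:R :> 'Z_n.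
  by rewrite rev_ordE reflective_Zp.
have c_ord_inj (r r' : 'I_n) : (c r)%:R = (c r')%:R :> 'Z_n -> r = r'.
  wlog lt_r : r r' / (r < n./2)%N => [wlog_r cc|cc].
    have [lt_r|le_r] := ltnP r n./2; first exact: wlog_r.
    apply/rev_ord_inj/wlog_r; first by rewrite rev_ordE; have := ltn_ord r; lia.
    by rewrite !c_rev -!natr1 cc.
  have [lt_r'|le_r'] := ltnP r' n./2; first by apply/val_inj/c_inj/Zp_natrP.
  have lt_r'' : (rev_ord r' < n./2)%N by rewrite rev_ordE; have := ltn_ord r'; lia.
  case: (c_opp _ _ lt_r lt_r''); apply/Zp_natrP => //.
  (* Adding 1 turns n - 1 into n, which is 0 in ['Z_n]. *)
  apply: (addIr 1); rewrite !natr1 prednK ?(ltnW n_gt1) // pchar_Zp //.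
  by rewrite -addnS natrD cc -[r']rev_ordK c_rev rev_ordK addNr.
split=> [r|j] x; apply: card_fiber_inj.
  move=> j j' /(congr1 (fun i : 'I_n => i%:R : 'Z_n)).
  by rewrite !cyclic_array_Zp // => /addrI; apply: ord_Zp_inj.
move=> r r' /(congr1 (fun i : 'I_n => i%:R : 'Z_n)).
by rewrite !cyclic_array_Zp // => /addIr; apply: c_ord_inj.
Qed.

(** In row r the symbol x forces the column x - f r, so occurrences project injectively to rows; the
    second symbol is then y exactly when g r - f r = y - x. *)
Lemma occurrences_cyclic (n : nat) (f g : nat -> nat) (x y : 'I_n) :
  (1 < n)%N ->
  occurrences (superimposition (cyclic_array n f) (cyclic_array n g)) (x, y) =
  #|[set r : 'I_n | (g r)%:R - (f r)%:R == y%:R - x%:R :> 'Z_n]|.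
Proof.
move=> n_gt1; rewrite /occurrences.
have pairE (p : 'I_n * 'I_n) :
    (superimposition (cyclic_array n f) (cyclic_array n g) p.1 p.2 == (x, y)) =
    ((f p.1)%:R + p.2%:R == x%:R :> 'Z_n) && ((g p.1)%:R + p.2%:R == y%:R :> 'Z_n).
  rewrite mxE xpair_eqE -!cyclic_array_Zp //.
  by congr (_ && _); apply/eqP/eqP => [->//|/ord_Zp_inj->].
rewrite -(card_in_imset (f := fst)) => [|[r j] [r' j']]; last first.
  rewrite !inE !pairE /= => /andP[/eqP fx _] /andP[/eqP fx' _] rr'; subst r'.
  by congr (_, _); apply: ord_Zp_inj => //; apply: (addrI (f r)%:R); rewrite fx.
apply: eq_card => r; rewrite inE; apply/imsetP/eqP => [[[r' j] + ->]|dr].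
  rewrite inE pairE /= => /andP[/eqP<- /eqP<-].
  by rewrite opprD addrACA subrr addr0.
have [j jE] : exists j : 'I_n, j%:R = x%:R - (f r)%:R :> 'Z_n.
  set z : 'Z_n := _ - _.
  have lt_z : (z < n)%N by rewrite -[n in (_ < n)%N]Zp_cast.
  by exists (Ordinal lt_z); rewrite natr_Zp.
exists (r, j) => //; rewrite inE pairE /= jE.
by rewrite subrKC eqxx addrCA dr subrKC eqxx.
Qed.

(** The last three hypotheses say, without subtraction, that d = g - f is nonzero and injective up
    to sign on the lower half. Concluding r = r' from opposite values leaves room for d r = n/2,
    which is its own opposite. *)
Lemma nearly_orthogonal_cyclic (n : nat) (f g : nat -> nat) :
  (1 < n)%N -> ~~ odd n -> reflective n f -> reflective n g ->
  (forall r, (r < n./2)%N -> f r <> g r %[mod n]) ->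
  (forall r r', (r < n./2)%N -> (r' < n./2)%N ->
     g r + f r' = g r' + f r %[mod n] -> r = r')%N ->
  (forall r r', (r < n./2)%N -> (r' < n./2)%N ->
     g r + g r' = f r + f r' %[mod n] -> r = r')%N ->
  nearly_orthogonal (cyclic_array n f) (cyclic_array n g).
Proof.
move=> n_gt1 n_even f_refl g_refl gf_neq gf_diff gf_sum.
pose d r : 'Z_n := (g r)%:R - (f r)%:R.
have d_rev (r : 'I_n) : d (rev_ord r) = - d r.
  by rewrite rev_ordE /d !reflective_Zp // -!natr1; ring.
have gE r : (g r)%:R = d r + (f r)%:R by rewrite subrK.
have d_inj r r' : (r < n./2)%N -> (r' < n./2)%N ->
    d r = d r' \/ d r = - d r' -> r = r'.
  move=> ltr ltr' [] dd; [apply: gf_diff | apply: gf_sum] => //;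
    apply/Zp_natrP => //.
    by rewrite !natrD !gE dd; ring.
  by rewrite !natrD !gE dd; ring.
have surj : forall z, z != 0 -> exists2 r, (r < n./2)%N & d r = z \/ d r = - z.
  apply: surj_up_to_sign => // r ltr.
  by rewrite subr_eq0; apply/eqP => /esym /(Zp_natrP _ _ n_gt1); apply: gf_neq.
split=> // x y.
  move=> x_neq_y; rewrite occurrences_cyclic //.
  have [|r ltr dr] := surj (y%:R - x%:R).
    rewrite subr_eq0; apply: contraNneq x_neq_y => yx; apply/eqP.
    by apply: ord_Zp_inj.
  have ltrn : (r < n)%N by lia.
  apply/card_gt0P; case: dr => dr.
    by exists (Ordinal ltrn); rewrite inE -dr.
  (* If [d r] has the wrong sign, the reflected row has the right one. *)
  exists (rev_ord (Ordinal ltrn)); rewrite inE; apply/eqP.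
  by rewrite -/(d _) d_rev /= dr opprK.
move=> yx; rewrite occurrences_cyclic //.
have -> : y%:R - x%:R = n./2%:R :> 'Z_n.
  by apply/eqP; rewrite subr_eq addrC -natrD Zp_natr_eq // yx.
have half_opp : - n./2%:R = n./2%:R :> 'Z_n.
  apply/eqP; rewrite eq_sym -addr_eq0 -natrD addnn halfK.
  by rewrite (negPf n_even) subn0 pchar_Zp.
have [|r0 lt_r0 dr0] := surj n./2%:R.
  rewrite -[0]/(0%:R) Zp_natr_eq // mod0n modn_small; lia.
have {}dr0 : d r0 = n./2%:R by case: dr0; rewrite ?half_opp.
have lt_r0n : (r0 < n)%N by lia.
pose i0 := Ordinal lt_r0n.
have uniq_r0 (r : 'I_n) : (r < n./2)%N -> d r = n./2%:R -> r = i0.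
  by move=> ltr dr; apply/val_inj/d_inj => //=; left; rewrite dr dr0.
have card2 : #|[set i0; rev_ord i0]| = 2%N.
  rewrite cards2; suff -> : i0 != rev_ord i0 by [].
  by apply/eqP => /(congr1 (@nat_of_ord n)); rewrite rev_ordE /=; lia.
(* The rows with difference n/2 are [i0] and its reflection: an upper row with this difference
   reflects to a lower one, which must be [i0]. *)
rewrite -[RHS]card2; apply: eq_card => r.
rewrite !inE -/(d r); apply/eqP/orP => [dr|].
  have [ltr|ler] := ltnP r n./2; first by left; rewrite (uniq_r0 r).
  right; apply/eqP; rewrite -(uniq_r0 (rev_ord r)) ?rev_ordK //.
    by rewrite rev_ordE; have := ltn_ord r; lia.
  by rewrite d_rev dr.
by case=> /eqP->; rewrite ?d_rev dr0.
Qed.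

(** For even n, the shift by n/2 is an involution modulo n. *)
Lemma nearly_orthogonal_sym (n : nat) (L M : 'M['I_n]_n) :
  nearly_orthogonal L M -> nearly_orthogonal M L.
Proof.
case=> n_even LM_gt0 LM_eq2.
have occC x y : occurrences (superimposition M L) (x, y) =
                occurrences (superimposition L M) (y, x).
  by apply: eq_card => p; rewrite !inE !mxE !xpair_eqE andbC.
split; first exact: n_even; move=> x y; rewrite occC.
  by rewrite eq_sym; apply: LM_gt0.
move=> yx.
apply: LM_eq2; rewrite -modnDml yx modnDml -addnA addnn halfK (negPf n_even).
by rewrite subn0 modnDr.
Qed.

(** Symmetry leaves three of the six ordered pairs to check. *)
Lemma mutually_nearly_orthogonal3 (n : nat) (A B C : 'M['I_n]_n) :
  latin_square A -> latin_square B -> latin_square C ->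
  nearly_orthogonal A B -> nearly_orthogonal A C -> nearly_orthogonal B C ->
  mutually_nearly_orthogonal_latin_squares [tuple A; B; C].
Proof.
move=> LA LB LC AB AC BC.
split=> [[[|[|[|a]]] lt_a]|[[|[|[|a]]] lt_a] [[|[|[|b]]] lt_b] ab];
  try discriminate; rewrite ?(tnth_nth A); try assumption;
  first [apply: nearly_orthogonal_sym; assumption | case/eqP: ab; exact: val_inj].
Qed.

(** * The three columns by residues of rows modulo 8 *)

(* arm2 k s e and arm3 k s e represent c2 and c3 at the row 8 s + e; the steps 2
   and 6 come from 4 (12 k + 10) = n + 2 and 4 (12 k + 11) = n + 6. *)
Definition arm2 (k s e : nat) : nat :=
  (if odd e then 12 * k + 9 else 30 * k + 23) + e./2 * (12 * k + 10) + 2 * s.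

Definition arm3 (k s e : nat) : nat :=
  (if odd e then 24 * k + 20 else 30 * k + 24) + e./2 * (12 * k + 11) + 6 * s.

Lemma c2_arm (k s e : nat) : (8 * s + e < 24 * k + 19)%N ->
  c2 k (8 * s + e) = (arm2 k s e %% (48 * k + 38))%N.
Proof.
move=> lt_r; rewrite /c2 /extend_by_reflection.
have -> : (8 * s + e < (48 * k + 38)./2)%N by lia.
have -> : odd (8 * s + e) = odd e by lia.
have -> : ((8 * s + e)./2 = 4 * s + e./2)%N by lia.
(* The 4 s increments contribute s (n + 2); adding s n on the right makes the two sides equal before
   reduction. *)
rewrite /arm2 -[RHS](modnMDl s); congr (_ %% _)%N.
by case: (odd e); nia.
Qed.

Lemma c3_arm (k s e : nat) : (8 * s + e < 24 * k + 19)%N ->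
  c3 k (8 * s + e) = (arm3 k s e %% (48 * k + 38))%N.
Proof.
move=> lt_r; rewrite /c3 /extend_by_reflection.
have -> : (8 * s + e < (48 * k + 38)./2)%N by lia.
have -> : odd (8 * s + e) = odd e by lia.
have -> : ((8 * s + e)./2 = 4 * s + e./2)%N by lia.
rewrite /arm3 -[RHS](modnMDl s); congr (_ %% _)%N.
by case: (odd e); nia.
Qed.

Lemma order_gt1 (k : nat) : (1 < 48 * k + 38)%N.
Proof. by lia. Qed.

Lemma order_even (k : nat) : ~~ odd (48 * k + 38).
Proof. by lia. Qed.

Lemma half_order (k : nat) : ((48 * k + 38)./2 = 24 * k + 19)%N.
Proof. by lia. Qed.

Lemma lower_halfP (k r : nat) : (r < (48 * k + 38)./2)%N ->
  exists s e, [/\ e < 8, 8 * s + e < 24 * k + 19 & r = 8 * s + e]%N.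
Proof.
rewrite half_order => lt_r; have rE : (r = 8 * (r %/ 8) + r %% 8)%N by lia.
by exists (r %/ 8)%N, (r %% 8)%N; rewrite -rE ltn_mod.
Qed.

Ltac unfold_arms :=
  rewrite ?c2_arm ?c3_arm // ?modnDml ?modnDmr ?modn_mod /c1 => /eqn_mod_near;
  rewrite /arm2 /arm3.

Ltac case_residue e lt_e8 lt_r :=
  case: e lt_e8 lt_r => [|[|[|[|[|[|[|[|e]]]]]]]] // _ lt_r.

(* With concrete residues modulo 8 of the row numbers, everything is affine in
   k and the quotients s, s'. *)
Ltac compare_rows :=
  let s := fresh "s" in let e := fresh "e" in
  let lt_e8 := fresh "lt_e8" in let lt_r := fresh "lt_r" in
  let s' := fresh "s'" in let e' := fresh "e'" in
  let lt_e8' := fresh "lt_e8'" in let lt_r' := fresh "lt_r'" in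
  move=> ? ? /lower_halfP[s [e [lt_e8 lt_r ->]]];
  move=> /lower_halfP[s' [e' [lt_e8' lt_r' ->]]];
  unfold_arms; case_residue e lt_e8 lt_r; case_residue e' lt_e8' lt_r';
  rewrite /=; lia.

Ltac check_row :=
  let s := fresh "s" in let e := fresh "e" in
  let lt_e8 := fresh "lt_e8" in let lt_r := fresh "lt_r" in
  move=> ? /lower_halfP[s [e [lt_e8 lt_r ->]]];
  unfold_arms; case_residue e lt_e8 lt_r; rewrite /=; lia.

(** * Verification for the three arrays *)

Lemma latin_square_c1 (k : nat) : latin_square (cyclic_array (48 * k + 38) c1).
Proof.
apply: (latin_square_cyclic (order_gt1 k) (order_even k)).
- exact: reflective_id.
- by move=> r r' lt_r lt_r'; rewrite /c1 !modn_small //; lia.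
(* Two lower rows sum to at most n - 2. *)
- by move=> r r' lt_r lt_r'; rewrite /c1 !modn_small //; lia.
Qed.

Lemma latin_square_c2 (k : nat) :
  latin_square (cyclic_array (48 * k + 38) (c2 k)).
Proof.
apply: (latin_square_cyclic (order_gt1 k) (order_even k)).
- exact: reflective_extend (order_even k).
- compare_rows.
- compare_rows.
Qed.

Lemma latin_square_c3 (k : nat) :
  latin_square (cyclic_array (48 * k + 38) (c3 k)).
Proof.
apply: (latin_square_cyclic (order_gt1 k) (order_even k)).
- exact: reflective_extend (order_even k).
- compare_rows.
- compare_rows.
Qed.

Lemma nearly_orthogonal_c1_c2 (k : nat) :
  nearly_orthogonal (cyclic_array (48 * k + 38) c1)
                    (cyclic_array (48 * k + 38) (c2 k)).
Proof.
apply: (nearly_orthogonal_cyclic (order_gt1 k) (order_even k)).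
- exact: reflective_id.
- exact: reflective_extend (order_even k).
- check_row.
- compare_rows.
- compare_rows.
Qed.

Lemma nearly_orthogonal_c1_c3 (k : nat) :
  nearly_orthogonal (cyclic_array (48 * k + 38) c1)
                    (cyclic_array (48 * k + 38) (c3 k)).
Proof.
apply: (nearly_orthogonal_cyclic (order_gt1 k) (order_even k)).
- exact: reflective_id.
- exact: reflective_extend (order_even k).
- check_row.
- compare_rows.
- compare_rows.
Qed.

Lemma nearly_orthogonal_c2_c3 (k : nat) :
  nearly_orthogonal (cyclic_array (48 * k + 38) (c2 k))
                    (cyclic_array (48 * k + 38) (c3 k)).
Proof.
apply: (nearly_orthogonal_cyclic (order_gt1 k) (order_even k)).
- exact: reflective_extend (order_even k).
- exact: reflective_extend (order_even k).
- check_row.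
- compare_rows.
- compare_rows.
Qed.

Theorem theorem5 (k : nat) :
  mutually_nearly_orthogonal_latin_squares
    [tuple cyclic_array (48 * k + 38) c1;
           cyclic_array (48 * k + 38) (c2 k);
           cyclic_array (48 * k + 38) (c3 k)].
Proof.
apply: mutually_nearly_orthogonal3.
- exact: latin_square_c1.
- exact: latin_square_c2.
- exact: latin_square_c3.
- exact: nearly_orthogonal_c1_c2.
- exact: nearly_orthogonal_c1_c3.
- exact: nearly_orthogonal_c2_c3.
Qed.
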